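(* There is no functor $M:\mathfrak{H}\to\mathbf{Gra}$ such that $M(G)=\Gamma(G)$ for all set-system hypergraphs $G$.
   Context: $\mathcal{P}$ denotes the covariant power-set functor on sets, with $\mathcal P(f)(A)=\{f(x):x\in A\}$. A set-system hypergraph is a triple $G=(E(G),\epsilon_G,V(G))$, where $E(G)$ (edges) and $V(G)$ (vertices) are sets and $\epsilon_G:E(G)\to\mathcal P(V(G))$ is a function. The category $\mathfrak H$ has set-system hypergraphs as objects; a morphism $\phi:G\to H$ is a pair of functions $E(\phi):E(G)\to E(H)$, $V(\phi):V(G)\to V(H)$ with $\epsilon_H(E(\phi)(e))=\mathcal P(V(\phi))(\epsilon_G(e))$ for all $e\in E(G)$. The category $\mathbf{Gra}$: objects are graphs $G=(V(G),E(G))$, with $V(G)$ a set and $E(G)\subseteq\mathcal P(V(G))$ such that every $A\in E(G)$ has $1\le\operatorname{card}(A)\le 2$; a morphism $f:G\to G'$ is a function $f:V(G)\to V(G')$ such that $A\in E(G)$ implies $\mathcal P(f)(A)\in E(G')$. Clique-replacement graph: for a set-system hypergraph $G$, $\Gamma(G)$ is the graph with vertex set $V(G)$ and edge set $\{\{v,w\}: v\ne w,\ \exists e\in E(G)\ (\{v,w\}\subseteq\epsilon_G(e))\}$. *)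

(* Defs.v *)
From mathcomp Require Import all_boot.
From mathcomp Require Import boolp classical_sets functions cardinality.

Set Implicit Arguments.
Unset Strict Implicit.
Unset Printing Implicit Defensive.

Local Open Scope classical_set_scope.
Local Open Scope card_scope.

Record category := Category {
  obj :> Type;
  hom : obj -> obj -> Type;
  idm : forall a, hom a a;
  compm : forall a b c, hom b c -> hom a b -> hom a c;
  compm1 : forall a b (f : hom a b), compm f (idm a) = f;
  comp1m : forall a b (f : hom a b), compm (idm b) f = f;
  compmA : forall a b c d (h : hom c d) (g : hom b c) (f : hom a b),
    compm h (compm g f) = compm (compm h g) f
}.

Record functor (C D : category) := Functor {
  fobj :> C -> D;
  fmap : forall a b : C, hom a b -> hom (fobj a) (fobj b);
  fmap1 : forall a : C, fmap (idm a) = idm (fobj a);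
  fmapM : forall (a b c : C) (g : hom b c) (f : hom a b),
    fmap (compm g f) = compm (fmap g) (fmap f)
}.

(* [set V] plays the role of the power set of V, and [f @` A] of P(f)(A). *)

Record hypergraph := Hypergraph {
  hedge : Type;
  hvertex : Type;
  incidence : hedge -> set hvertex
}.

Record hypergraph_hom (G H : hypergraph) := HypergraphHom {
  hom_edge : hedge G -> hedge H;
  hom_vertex : hvertex G -> hvertex H;
  hom_incidence : forall e : hedge G,
    incidence (hom_edge e) = hom_vertex @` incidence e
}.

Lemma hypergraph_hom_eq (G H : hypergraph) (f g : hypergraph_hom G H) :
  hom_edge f = hom_edge g -> hom_vertex f = hom_vertex g -> f = g.
Proof.
case: f g => [fE fV fP] [gE gV gP] /= EE EV.
by move: fP gP; rewrite EE EV => fP gP; rewrite (Prop_irrelevance fP gP).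
Qed.

Lemma hypergraph_id_subproof (G : hypergraph) (e : hedge G) :
  incidence (id e) = id @` incidence e.
Proof. by rewrite image_id. Qed.

Definition hypergraph_id (G : hypergraph) : hypergraph_hom G G :=
  HypergraphHom (@hypergraph_id_subproof G).

Lemma hypergraph_comp_subproof (G H K : hypergraph)
    (g : hypergraph_hom H K) (f : hypergraph_hom G H) (e : hedge G) :
  incidence ((hom_edge g \o hom_edge f) e)
  = (hom_vertex g \o hom_vertex f) @` incidence e.
Proof. by rewrite /= !hom_incidence image_comp. Qed.

Definition hypergraph_comp (G H K : hypergraph)
    (g : hypergraph_hom H K) (f : hypergraph_hom G H) : hypergraph_hom G K :=
  HypergraphHom (hypergraph_comp_subproof g f).

Definition Hyp : category.
Proof.
apply: (@Category hypergraph hypergraph_hom hypergraph_id hypergraph_comp).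
- by move=> *; apply: hypergraph_hom_eq.
- by move=> *; apply: hypergraph_hom_eq.
- by move=> *; apply: hypergraph_hom_eq.
Defined.

Record graph := Graph {
  vertex : Type;
  edges : set (set vertex);
  edges_card : forall A, edges A -> (`I_1 #<= A) /\ (A #<= `I_2)
}.

Record graph_hom (G H : graph) := GraphHom {
  hom_fun :> vertex G -> vertex H;
  hom_edges : forall A, edges A -> edges (hom_fun @` A)
}.

Lemma graph_hom_eq (G H : graph) (f g : graph_hom G H) :
  hom_fun f = hom_fun g -> f = g.
Proof.
case: f g => [f fP] [g gP] /= E.
by move: fP gP; rewrite E => fP gP; rewrite (Prop_irrelevance fP gP).
Qed.

Lemma graph_id_subproof (G : graph) (A : set (vertex G)) :
  edges A -> edges (id @` A).
Proof. by rewrite image_id. Qed.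

Definition graph_id (G : graph) : graph_hom G G :=
  GraphHom (@graph_id_subproof G).

Lemma graph_comp_subproof (G H K : graph)
    (g : graph_hom H K) (f : graph_hom G H) (A : set (vertex G)) :
  edges A -> edges ((g \o f) @` A).
Proof. by move=> EA; rewrite -image_comp; do 2!apply: hom_edges. Qed.

Definition graph_comp (G H K : graph)
    (g : graph_hom H K) (f : graph_hom G H) : graph_hom G K :=
  GraphHom (graph_comp_subproof g f).

Definition Gra : category.
Proof.
apply: (@Category graph graph_hom graph_id graph_comp).
- by move=> *; apply: graph_hom_eq.
- by move=> *; apply: graph_hom_eq.
- by move=> *; apply: graph_hom_eq.
Defined.

Definition clique_edges (G : hypergraph) : set (set (hvertex G)) :=
  [set A | exists v w : hvertex G, [/\ A = [set v; w], v <> w &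
    exists e : hedge G, [set v; w] `<=` incidence e]].

Lemma clique_edges_card (G : hypergraph) (A : set (hvertex G)) :
  clique_edges A -> (`I_1 #<= A) /\ (A #<= `I_2).
Proof.
case=> v [w [-> _ _]]; split.
  rewrite -(card_le_eql (@card_set1 _ v)); apply: subset_card_le.
  by move=> x ->; left.
suff -> : [set v; w] = (fun n => if n == 0 then v else w) @` `I_2.
  exact: card_image_le.
apply/predeqP => x; split; first by case=> ->; [exists 0|exists 1].
by case=> n _ <-; case: (n == 0); [left|right].
Qed.

Definition clique_graph (G : hypergraph) : graph :=
  Graph (@clique_edges_card G).

(* Main.v *)
(* Collapsing a single edge on two vertices onto a single edge on one vertex is
   a morphism of set-system hypergraphs, but the clique-replacement graphs are
   K_2 and an edgeless point, between which there is no graph homomorphism at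
   all; so no choice of action on morphisms can work. *)
From mathcomp Require Import all_boot.
From mathcomp Require Import classical_sets.
Require Import Defs.

Local Open Scope classical_set_scope.

Definition full_edge (V : Type) : hypergraph :=
  @Hypergraph unit V (fun=> setT).

Lemma collapse_subproof (e : hedge (full_edge bool)) :
  @incidence (full_edge unit) (id e)
  = (fun=> tt) @` @incidence (full_edge bool) e.
(* Incidence must be preserved as an equality of sets, so [tt] needs a preimage; either boolean
   would do. *)
Proof. by apply/seteqP; split=> [[] _|[]] //; exists true. Qed.

Definition collapse : hypergraph_hom (full_edge bool) (full_edge unit) :=
  @HypergraphHom (full_edge bool) (full_edge unit) id (fun=> tt)
    collapse_subproof.

(** Clique edges join distinct vertices, so the target has no loop to receive the edge between
    [true] and [false]. *)
Lemma clique_graph_full_edge_no_hom :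
  graph_hom (clique_graph (full_edge bool)) (clique_graph (full_edge unit)) ->
  False.
Proof.
move=> f; have Ebool : @edges (clique_graph (full_edge bool)) [set true; false].
  by exists true, false; split=> //; exists tt.
(* The image edge would have distinct endpoints in [unit], yet both are [tt]. *)
by have [[] [[] [_ /(_ erefl)]]] := hom_edges f Ebool.
Qed.

Theorem proposition2p12 :
  ~ exists M : functor Hyp Gra, forall G : hypergraph, M G = clique_graph G.
Proof.
move=> [M ME].
have := @fmap _ _ M (full_edge bool) (full_edge unit) collapse.
(* Only the existence of the homomorphism matters, so its type can be rewritten along the object
   equalities [ME]. *)
by rewrite !ME; apply: clique_graph_full_edge_no_hom.
Qed.
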